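(* Let $G_{\mathcal{F}}=(V,\mathcal{F})$ be a simple graph with $m=|\mathcal{F}|\ge 1$ edges and degrees $(d_1,\dots,d_n)$, and let $\delta$ be defined by $\frac{1}{m}\sum_u d_u^2=m+1-\delta$. Then there exists an edge $\{u,v\}\in\mathcal{F}$ with $d_u+d_v-1\ge m-\delta$. Furthermore, if $\delta<\frac12$, then $\delta=0$ and $G_{\mathcal{F}}$ (ignoring isolated vertices) is either a star or a triangle. *)

(* Defs.v *)
From mathcomp Require Import all_boot all_order all_algebra.
Set Implicit Arguments.
Unset Strict Implicit.
Unset Printing Implicit Defensive.

(* A simple graph (V, F) is given by its edge set F, whose elements are        *)
(* 2-element subsets of the finite vertex type V.                              *)
Definition simple_graph (V : finType) (F : {set {set V}}) : Prop :=
  forall e, e \in F -> #|e| = 2.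

Definition degree (V : finType) (F : {set {set V}}) (u : V) : nat :=
  #|[set e in F | u \in e]|.

Definition non_isolated (V : finType) (F : {set {set V}}) : {set V} :=
  [set u | degree F u != 0].

(* The graph with vertex set W and edge set F is a star K_{1,k}, k >= 0.       *)
Definition is_star (V : finType) (W : {set V}) (F : {set {set V}}) : Prop :=
  exists2 c, c \in W & F = [set [set c; v] | v in W :\ c].

(* The graph with vertex set W and edge set F is the complete graph K_3.       *)
Definition is_triangle (V : finType) (W : {set V}) (F : {set {set V}}) : Prop :=
  #|W| = 3 /\ F = [set e : {set V} | (e \subset W) && (#|e| == 2)].

(* Main.v *)
Require Import Defs.
From mathcomp Require Import all_boot all_order all_algebra.
From mathcomp Require Import zify ring lra.
Set Implicit Arguments.
Unset Strict Implicit.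
Unset Printing Implicit Defensive.
Import Order.TTheory GRing.Theory Num.Theory.
Local Open Scope ring_scope.

                                                                               
                                                                                 
                                                                          
                                                                            
                                                                                
                                                                              
                                                                              
                                                                 
                                                                             
                

(** Write [m] for the number of edges and x(e) for the number of edges disjoint from the edge e =
    {u,v}. Two edges share exactly one vertex unless they are equal or disjoint, so counting
    incidences gives d_u + d_v + x(e) = m + 1 ([sum_degree_disjoint_degree]). Summing over all edges
    turns the definition of [delta] into S = [delta] m, where S is the sum of the x(e)
    ([sum_degree_sqr_disjoint_degree]). An edge minimizing x has x(e) at most the average [delta],
    which is the first claim. If [delta] < 1/2, this integer x(e) is 0 and 2S < m. Every edge then
    passes through u or v, and a single disjoint pair would force too many others, because an edge
    at u only misses all but at most one of the edges at v only ([intersecting_of_few_disjoint]). So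
    all edges meet pairwise, S = 0, and a pairwise intersecting family of edges is a star or a
    triangle ([intersecting_star_or_triangle]). *)

Section Graph.

Variables (V : finType) (F : {set {set V}}).
Implicit Types (u v w : V) (e f g : {set V}).
Local Open Scope nat_scope.

(** Written as a sum of booleans over [F], so that it can be added term by term to the incidence
    count of [sum_degree]. *)
Definition disjoint_degree e : nat := \sum_(f in F) (e :&: f == set0).

Lemma set2E e u v : #|e| = 2 -> u \in e -> v \in e -> u != v -> e = [set u; v].
Proof.
move=> ce ue ve uv; apply/esym/eqP.
by rewrite eqEcard subUset !sub1set ue ve cards2 uv ce.
Qed.

Lemma set2_other e u : #|e| = 2 -> u \in e ->
  exists2 v, u != v & e = [set u; v].
Proof.
move=> ce ue; have /card_gt0P[v] : 0 < #|e :\ u|.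
  by have := cardsD1 u e; rewrite ue ce; lia.
rewrite !inE => /andP[vu ve]; exists v; first by rewrite eq_sym.
by apply: set2E => //; rewrite eq_sym.
Qed.

Lemma cardI_set2 e f : #|e| = 2 -> #|f| = 2 ->
  #|e :&: f| + (e :&: f == set0) = 1 + (e == f).
Proof.
move=> ce cf; case: (eqVneq e f) => [->|ef].
  by rewrite setIid cf -cards_eq0 cf.
rewrite -cards_eq0.
have: #|e :&: f| < 2.
  rewrite -ce ltn_neqAle subset_leq_card ?subsetIl // andbT.
  apply: contra ef => /eqP H.
  have: e :&: f == e by rewrite eqEcard subsetIl H leqnn.
  by move/eqP/setIidPl => s; rewrite eqEcard s ce cf.
by case: #|_| => [|[|]].
Qed.

(** Both sides count the pairs of a vertex [u] of [e] and an edge [f] through [u]. *)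
Lemma sum_degree e : \sum_(u in e) degree F u = \sum_(f in F) #|e :&: f|.
Proof.
have degE u : degree F u = \sum_(f in F | u \in f) 1.
  by rewrite /degree -sum1_card; apply: eq_bigl => f; rewrite inE.
rewrite (eq_bigr _ (fun u _ => degE u)).
rewrite (exchange_big_dep (mem F)) /=; last by move=> u f _ /andP[].
apply: eq_bigr => f fF; rewrite -sum1_card.
by apply: eq_bigl => u; rewrite inE fF andTb.
Qed.

Hypothesis simpleF : simple_graph F.

(** By [cardI_set2] each edge [f] contributes 1 to the left side, except [e] itself, which
    contributes 2. *)
Lemma sum_degree_disjoint_degree e : e \in F ->
  \sum_(u in e) degree F u + disjoint_degree e = #|F| + 1.
Proof.
move=> eF; rewrite sum_degree -big_split /=.
rewrite (eq_bigr (fun f => 1 + (e == f))); last first.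
  by move=> f fF; apply: cardI_set2; apply: simpleF.
rewrite big_split sum1_card /= (bigD1 e) //= eqxx big1 // => f /andP[_ fe].
by rewrite eq_sym (negbTE fe).
Qed.

(** On the right, a vertex contributes its degree once for every edge through it. *)
Lemma sum_degree_sqr :
  \sum_u degree F u ^ 2 = \sum_(e in F) \sum_(u in e) degree F u.
Proof.
rewrite (exchange_big_dep predT) //=; apply: eq_bigr => u _.
rewrite big_const iter_addn_0 expnS expn1; congr (_ * _).
by apply: eq_card => e; rewrite !inE.
Qed.

Lemma sum_degree_sqr_disjoint_degree :
  \sum_u degree F u ^ 2 + \sum_(e in F) disjoint_degree e = #|F| * (#|F| + 1).
Proof.
rewrite sum_degree_sqr -big_split /= (eq_bigr (fun=> #|F| + 1)).
  by rewrite big_const iter_addn_0 mulnC.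
by move=> e /sum_degree_disjoint_degree.
Qed.

Lemma disjoint_degree_eq0 e : disjoint_degree e = 0 ->
  {in F, forall f, e :&: f != set0}.
Proof.
move=> /eqP; rewrite sum_nat_eq0 => /forallP H f fF.
by move: (H f); rewrite fF /= eqb0.
Qed.

Lemma star_of_center c : F != set0 -> {in F, forall e, c \in e} ->
  is_star (non_isolated F) F.
Proof.
move=> /set0Pn[e0 e0F] cF.
have nonisoP v : reflect (exists2 e, e \in F & v \in e) (v \in non_isolated F).
  rewrite inE -lt0n; apply: (iffP card_gt0P) => [[e]|[e eF ve]].
    by rewrite inE => /andP[]; exists e.
  by exists e; rewrite inE eF.
exists c; first by apply/nonisoP; exists e0 => //; apply: cF.
apply/setP => e; apply/idP/imsetP => [eF|[v]].
  have [v cv ev] := set2_other (simpleF eF) (cF _ eF).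
  exists v => //; rewrite in_setD1 eq_sym cv; apply/nonisoP.
  by exists e => //; rewrite ev !inE eqxx orbT.
rewrite in_setD1 => /andP[vc /nonisoP[f fF vf]] ->.
by rewrite -(set2E (simpleF fF) (cF _ fF) vf) // eq_sym.
Qed.

(** Fix an edge {u,v}. If neither [u] nor [v] is a common vertex, some edge [g] misses [v] and some
    [f] misses [u]; they contain [u] and [v] respectively and meet in a third vertex [w], which
    closes a triangle. *)
Lemma intersecting_star_or_triangle : F != set0 ->
  {in F &, forall e f, e :&: f != set0} ->
  is_star (non_isolated F) F \/ is_triangle (non_isolated F) F.
Proof.
move=> F0 intF; have /set0Pn[e eF] := F0.
have /card_gt0P[u ue] : 0 < #|e| by rewrite simpleF.
have [v uv ev] := set2_other (simpleF eF) ue; subst e => {ue}.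
have [/forall_inP uF|] := boolP [forall (f | f \in F), u \in f].
  by left; apply: star_of_center uF.
have [/forall_inP vF _|] := boolP [forall (f | f \in F), v \in f].
  by left; apply: star_of_center vF.
rewrite !negb_forall => /existsP[g]; rewrite negb_imply => /andP[gF vg].
move=> /existsP[f]; rewrite negb_imply => /andP[fF uf]; right.
have vf : v \in f.
  have /set0Pn[x] := intF _ _ eF fF.
  by rewrite !inE => /andP[/orP[]/eqP-> //]; rewrite (negbTE uf).
have ug : u \in g.
  have /set0Pn[x] := intF _ _ eF gF.
  by rewrite !inE => /andP[/orP[]/eqP-> //]; rewrite (negbTE vg).
have /set0Pn[w] := intF _ _ fF gF; rewrite inE => /andP[wf wg].
have uw : u != w by apply: contraNneq uf => ->.
have vw : v != w by apply: contraNneq vg => ->.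
have {ug wg vg} gE := set2E (simpleF gF) ug wg uw; subst g.
have {vf wf uf} fE := set2E (simpleF fF) vf wf vw; subst f.
have W3 : #|[set u; v; w]| = 3.
  rewrite setUC cardsU1 !inE cards2 uv.
  by rewrite negb_or eq_sym uw eq_sym vw.
have FE : F = [set e : {set V} | (e \subset [set u; v; w]) && (#|e| == 2)].
  apply/setP => e; rewrite inE; apply/idP/andP => [hF|[sub /eqP ce]].
    split; last by rewrite simpleF.
    apply/subsetP => z ze; apply: contraT; rewrite !inE !negb_or.
    move=> /andP[/andP[zu zv] zw].
    have [y zy eE] := set2_other (simpleF hF) ze; subst e.
    (* An edge {z,y} with [z] outside the triangle could meet its three sides only in [y], but no
       vertex lies on all three. *)
    have yP f : f \in F -> z \notin f -> y \in f.
      move=> fF' zf; have /set0Pn[x] := intF _ _ hF fF'.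
      by rewrite !inE => /andP[/orP[]/eqP-> //]; rewrite (negbTE zf).
    have := yP _ eF; have := yP _ fF; have := yP _ gF.
    rewrite !inE !negb_or zu zv zw => /(_ isT) y1 /(_ isT) y2 /(_ isT).
    case/orP: y1 => /eqP yE; subst y; move: y2.
      by rewrite (negbTE uv) (negbTE uw).
    by move=> _; rewrite !(eq_sym w) (negbTE uw) (negbTE vw).
  have [ue|ue] := boolP (u \in e); last first.
    suff -> : e = [set v; w] by [].
    apply/eqP; rewrite eqEcard ce cards2 vw andbT; apply/subsetP => x xe.
    have := subsetP sub x xe; rewrite !inE -orbA => /orP[/eqP xu|//].
    by rewrite -xu xe in ue.
  have [x ux eE] := set2_other ce ue; subst e.
  have := subsetP sub x; rewrite !inE eqxx orbT => /(_ isT).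
  by rewrite eq_sym (negbTE ux) /= => /orP[]/eqP->.
suff -> : non_isolated F = [set u; v; w] by [].
apply/setP => x; rewrite inE -lt0n; apply/card_gt0P/idP => [[e]|].
  by rewrite inE {1}FE inE => /andP[/andP[/subsetP sub _]] /sub.
rewrite !inE -orbA => /or3P[]/eqP->.
- by exists [set u; v]; rewrite !inE eF eqxx.
- by exists [set u; v]; rewrite !inE eF eqxx orbT.
- by exists [set u; w]; rewrite !inE gF eqxx orbT.
Qed.

                                                                          
(** If [w] is the other end of [f], the only member of [B] that can meet [f] is {v,w}. *)
Lemma card_le_disjoint_succ u v f (B : {set {set V}}) :
  #|f| = 2 -> u \in f -> v \notin f ->
  {in B, forall g, [/\ #|g| = 2, v \in g & u \notin g]} ->
  #|B| <= (\sum_(g in B) (f :&: g == set0)).+1.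
Proof.
move=> cf uf vf BP; have [w uw fE] := set2_other cf uf; subst f.
have vw : v != w by apply: contraNneq vf => ->; rewrite !inE eqxx orbT.
rewrite -sum1_card (eq_bigr (fun g => ([set u; w] :&: g == set0)
   + ([set u; w] :&: g != set0))); last by move=> g _; case: eqP.
rewrite big_split /= -addn1 leq_add2l.
apply: (@leq_trans (\sum_(g in B) (g == [set v; w]))).
  apply: leq_sum => g /BP[cg vg ug]; case: set0Pn => // -[x].
  rewrite !inE => /andP[/orP[]/eqP-> xg]; first by rewrite xg in ug.
  by rewrite (set2E cg vg xg vw) eqxx.
have [hB|hB] := boolP ([set v; w] \in B); last first.
  by rewrite big1 // => g gB; case: eqP => // gE; rewrite -gE gB in hB.
rewrite (bigD1 [set v; w]) //= eqxx big1 // => g /andP[_].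
by move/negbTE->.
Qed.

Lemma intersecting_of_few_disjoint e :
  e \in F -> {in F, forall f, e :&: f != set0} ->
  2 * \sum_(f in F) disjoint_degree f < #|F| ->
  {in F &, forall f g, f :&: g != set0}.
Proof.
move=> eF eP few f g fF gF; apply/negP => fg.
have /card_gt0P[u ue] : 0 < #|e| by rewrite simpleF.
have [v uv eE] := set2_other (simpleF eF) ue; subst e => {ue}.
(* Since {u,v} meets every edge, [A] holds the edges at [u] only and [B] those at [v] only. *)
pose A := [set f in F | v \notin f]; pose B := [set f in F | u \notin f].
have meet h : h \in F -> (u \in h) || (v \in h).
  move=> hF; have /set0Pn[x] := eP _ hF.
  by rewrite !inE => /andP[/orP[]/eqP-> ->]; rewrite ?orbT.
have AP : {in A, forall h : {set V}, [/\ #|h| = 2, u \in h & v \notin h]}.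
  move=> h; rewrite inE => /andP[hF vh]; split=> //; first exact: simpleF.
  by have := meet _ hF; rewrite (negbTE vh) orbF.
have BP : {in B, forall h : {set V}, [/\ #|h| = 2, v \in h & u \notin h]}.
  move=> h; rewrite inE => /andP[hF uh]; split=> //; first exact: simpleF.
  by have := meet _ hF; rewrite (negbTE uh).
have AB0 : A :&: B = set0.
  apply/setP => h; rewrite !in_setI in_set0; apply/negP => /andP[/AP[_ uh _]].
  by case/BP => _ _; rewrite uh.
pose T := \sum_(h in A) \sum_(k in B) (h :&: k == set0).
have TC : T = \sum_(k in B) \sum_(h in A) (k :&: h == set0).
  rewrite /T exchange_big; apply: eq_bigr => k _; apply: eq_bigr => h _.
  by rewrite setIC.
have cardF : #|F| <= 1 + #|A| + #|B|.
  have: F \subset [set [set u; v]] :|: A :|: B.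
    apply/subsetP => h hF; rewrite !inE hF /=.
    have [uh|] := boolP (u \in h); last by rewrite orbT.
    have [vh|] := boolP (v \in h); last by rewrite orbT.
    by rewrite (set2E (simpleF hF) uh vh uv) eqxx.
  move/subset_leq_card => H; apply: leq_trans H _.
  apply: leq_trans (leq_card_setU _ _) _; rewrite leq_add2r.
  by apply: leq_trans (leq_card_setU _ _) _; rewrite cards1.
have sub_sum (C D : {set {set V}}) (E : {set V} -> nat) : C \subset D ->
    \sum_(h in C) E h <= \sum_(h in D) E h.
  move=> CD; rewrite [leqRHS](big_setID C) /= (setIidPr CD).
  exact: leq_addr.
have sA : A \subset F by apply/subsetP => h; rewrite inE => /andP[].
have sB : B \subset F by apply/subsetP => h; rewrite inE => /andP[].
(* A disjoint pair across [A] and [B] is counted twice on the right, once from each of its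
   members. *)
have T2 : 2 * T <= \sum_(h in F) disjoint_degree h.
  have sBD : B \subset F :\: A by rewrite subsetD sB -setI_eq0 setIC AB0 eqxx.
  rewrite [leqRHS](big_setID A) /= (setIidPr sA).
  apply: leq_trans (leq_add (leqnn _) (sub_sum _ _ _ sBD)).
  rewrite mul2n -addnn {2}TC; apply: leq_add; apply: leq_sum => h _.
  - exact: sub_sum.
  - exact: sub_sum.
have Ta : #|A| * #|B|.-1 <= T.
  rewrite -sum_nat_const; apply: leq_sum => h /AP[ch uh vh].
  by have := card_le_disjoint_succ ch uh vh BP; lia.
have Tb : #|B| * #|A|.-1 <= T.
  rewrite TC -sum_nat_const; apply: leq_sum => h /BP[ch vh uh].
  by have := card_le_disjoint_succ ch vh uh AP; lia.
have posT f' g' : f' \in A -> g' \in B -> f' :&: g' == set0 ->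
    [/\ 0 < #|A|, 0 < #|B| & 0 < T].
  move=> fA gB fg'; split; [by apply/card_gt0P; exists f'| by apply/card_gt0P; exists g'|].
  by rewrite /T (bigD1 f') //= (bigD1 g') //= fg'.
(* The disjoint edges [f] and [g] cannot share [u] or [v], so one lies in [A] and the other in
   [B]. *)
have [a0 b0 T0] : [/\ 0 < #|A|, 0 < #|B| & 0 < T].
  have nI x : x \in f -> x \in g -> False.
    by move=> xf xg; have /setP/(_ x) := eqP fg; rewrite !inE xf xg.
  have [uf|uf] := boolP (u \in f).
    have ug : u \notin g by apply/negP => /(nI _ uf).
    have vg : v \in g by have := meet _ gF; rewrite (negbTE ug).
    have vf : v \notin f by apply/negP => /nI; apply.
    by apply: (posT f g); rewrite // inE ?fF ?gF.
  have vf : v \in f by have := meet _ fF; rewrite (negbTE uf).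
  have vg : v \notin g by apply/negP => /(nI _ vf).
  by apply: (posT g f); rewrite ?inE ?fF ?gF // setIC.
(* The bounds combine to 4T <= a + b. This fails for a = b = 1 because T >= 1. If only a = 1, then T
   >= b - 1 with b >= 2 refutes it, and symmetrically. If a, b >= 2, adding [Ta] and [Tb] gives 4ab
   <= 3(a + b), contradicting ab >= a + b. *)
move: Ta Tb T0 T2 few cardF a0 b0.
move: (\sum_(h in F) _) => S; move: T {TC posT} => T; move: #|F| #|A| #|B| => m a b.
by case: a => [|[|a]] //; case: b => [|[|b]] //=; nia.
Qed.

End Graph.

Theorem lemma1 (R : realFieldType) (V : finType) (F : {set {set V}})
    (delta : R) (simpleF : simple_graph F) (m_ge1 : (1 <= #|F|)%N)
    (delta_def : (1 / #|F|%:R) * (\sum_(u : V) (degree F u)%:R ^+ 2)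
                 = #|F|%:R + 1 - delta) :
  (exists u v : V, [set u; v] \in F /\
     #|F|%:R - delta <= (degree F u)%:R + (degree F v)%:R - 1)
  /\ (delta < 1 / 2%:R ->
      delta = 0 /\
      (is_star (non_isolated F) F \/ is_triangle (non_isolated F) F)).
Proof.
have m0 : 0 < #|F|%:R :> R by rewrite ltr0n.
pose S := (\sum_(e in F) disjoint_degree F e)%N.
have SE : S%:R = delta * #|F|%:R.
  have H := sum_degree_sqr_disjoint_degree simpleF.
  have {H} : (\sum_u (degree F u)%:R ^+ 2) + S%:R = #|F|%:R * (#|F|%:R + 1) :> R.
    rewrite -[1](mulr1n 1) -natrD -natrM -H natrD natr_sum; congr (_ + _).
    by apply: eq_bigr => u _; rewrite natrX.
  have {delta_def} -> : \sum_u (degree F u)%:R ^+ 2 = #|F|%:R * (#|F|%:R + 1 - delta).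
    by rewrite -delta_def; field; rewrite lt0r_neq0.
  by move=> H; lra.
have F0 : F != set0 by rewrite -card_gt0.
have [e0 e0F] := set0Pn _ F0.
have [e eF emin] : exists2 e, e \in F &
    {in F, forall f, (disjoint_degree F e <= disjoint_degree F f)%N}.
  by case: (arg_minnP (disjoint_degree F) e0F) => e; exists e.
(* The minimum is at most the average S/m = [delta]. *)
have xe : (disjoint_degree F e)%:R <= delta.
  rewrite -(ler_pM2r m0) -SE -natrM ler_nat mulnC -sum_nat_const.
  exact: leq_sum.
split.
  have /card_gt0P[u ue] : (0 < #|e|)%N by rewrite simpleF.
  have [v uv eE] := set2_other (simpleF _ eF) ue; exists u, v.
  split; first by rewrite -eE.
  have H : (degree F u + degree F v + disjoint_degree F e = #|F| + 1)%N.
    have := sum_degree_disjoint_degree simpleF eF.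
    rewrite {1}eE big_setU1 ?inE //=.
    by rewrite big_set1.
  have := congr1 (fun n => n%:R : R) H; rewrite !natrD => HR.
  by lra.
move=> dlt.
have x0 : disjoint_degree F e = 0%N.
  apply/eqP; rewrite -leqn0 -ltnS -(ltr_nat R); lra.
(* The threshold 1/2 enters here: 2S = 2 [delta] m < m. *)
have few : (2 * S < #|F|)%N.
  by rewrite -(ltr_nat R) natrM SE; nra.
have intF := intersecting_of_few_disjoint simpleF eF (disjoint_degree_eq0 x0) few.
split; last exact: intersecting_star_or_triangle.
have S0 : S = 0%N.
  rewrite /S big1 // => f fF; rewrite /disjoint_degree big1 // => g gF.
  by rewrite (negbTE (intF _ _ fF gF)).
by move/esym/eqP: SE; rewrite S0 mulf_eq0 (gt_eqF m0) orbF => /eqP.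
Qed.
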